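(* Let $(W,S)$ be a simply-laced triangle-free Coxeter system and let ${\boldsymbol{\alpha}}$ be a reduced expression for some nonidentity $w\in W$. Then there is an isometric embedding of the braid graph $B({\boldsymbol{\alpha}})$ into the hypercube $Q_{\operatorname{rank}({\boldsymbol{\alpha}})}$. In particular, $B({\boldsymbol{\alpha}})$ is a partial cube with isometric dimension at most $\operatorname{rank}({\boldsymbol{\alpha}})$.
   Context: A Coxeter system $(W,S)$ consists of a finite set $S$ and a group $W$ with presentation $\langle S \mid (st)^{m(s,t)}=e\rangle$, where $m(s,s)=1$ and $m(s,t)\in\{2,3,\dots,\infty\}$ for $s\neq t$ (symmetric). It is simply laced if $m(s,t)\le 3$ for all $s,t\in S$. Its Coxeter graph $\Gamma$ has vertex set $S$ and an edge $\{s,t\}$ whenever $m(s,t)\ge 3$; $(W,S)$ is triangle free if $\Gamma$ has no three-cycles. A reduced expression for $w$ is a word $s_{x_1}\cdots s_{x_m}$ in $S$ equal to $w$ with $m$ minimal. A braid move (in the simply-laced case) replaces a consecutive subword $sts$ by $tst$ where $m(s,t)=3$. Two reduced expressions are braid equivalent if one is obtained from the other by a finite sequence of braid moves; the equivalence class $[{\boldsymbol{\alpha}}]$ is the braid class. The braid graph $B({\boldsymbol{\alpha}})$ has vertex set $[{\boldsymbol{\alpha}}]$, two vertices adjacent iff they differ by a single braid move. For ${\boldsymbol{\alpha}}=s_{x_1}\cdots s_{x_m}$, an interval of positions $\llbracket i,i+2\rrbracket=\{i,i+1,i+2\}$ is a braid shadow of ${\boldsymbol{\alpha}}$ if $s_{x_i}=s_{x_{i+2}}$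 and $m(s_{x_i},s_{x_{i+1}})=3$. Let $\operatorname{bs}({\boldsymbol{\alpha}})$ be the set of braid shadows of ${\boldsymbol{\alpha}}$, $\operatorname{bs}([{\boldsymbol{\alpha}}])=\bigcup_{{\boldsymbol{\beta}}\in[{\boldsymbol{\alpha}}]}\operatorname{bs}({\boldsymbol{\beta}})$, and $\operatorname{rank}({\boldsymbol{\alpha}})=|\operatorname{bs}([{\boldsymbol{\alpha}}])|$. The hypercube $Q_r$ has vertex set $\{0,1\}^r$, two strings adjacent iff they differ in exactly one digit ($Q_0$ is a single vertex). An isometric embedding of a connected graph $G$ into $H$ is a map $V(G)\to V(H)$ preserving shortest-path distance. A partial cube is a graph admitting an isometric embedding into some hypercube; its isometric dimension is the least $m$ such that it isometrically embeds in $Q_m$. *)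

(* Defs.v *)
From HB Require Import structures.
From mathcomp Require Import all_boot.

Set Implicit Arguments.
Unset Strict Implicit.
Unset Printing Implicit Defensive.

Local Open Scope group_scope.

(* None stands for the value oo. *)
Record coxeter_matrix (S : finType) := CoxeterMatrix {
  cox_m :> S -> S -> option nat;
  cox_diag : forall s, cox_m s s = Some 1%N;
  cox_sym : forall s t, cox_m s t = cox_m t s;
  cox_offdiag : forall s t k, s != t -> cox_m s t = Some k -> 2 <= k
}.

Definition coxeter_relations (S : finType) (M : coxeter_matrix S)
    (G : groupType) (f : S -> G) : Prop :=
  forall s t k, M s t = Some k -> (f s * f t) ^+ k = 1.

(* W = < S | (st)^m(s,t) = 1 >: the map gen : S -> W satisfies the relations
   and is universal among the maps from S to a group that satisfy them. *)
Definition coxeter_system (S : finType) (M : coxeter_matrix S)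
    (W : groupType) (gen : S -> W) : Prop :=
  coxeter_relations M gen /\
  forall (G : groupType) (f : S -> G), coxeter_relations M f ->
    (exists phi : {multiplicative W -> G}, forall s, phi (gen s) = f s) /\
    (forall phi psi : {multiplicative W -> G},
       (forall s, phi (gen s) = f s) -> (forall s, psi (gen s) = f s) ->
       phi =1 psi).

Definition simply_laced (S : finType) (M : coxeter_matrix S) : Prop :=
  forall s t, exists2 k, M s t = Some k & k <= 3.

Definition coxeter_edge (S : finType) (M : coxeter_matrix S) : rel S :=
  fun s t => if M s t is Some k then 3 <= k else true.

(* coxeter_edge is irreflexive by cox_diag, so that s, t and u below
   are pairwise distinct. *)
Definition triangle_free (S : finType) (M : coxeter_matrix S) : Prop :=
  forall s t u,
    ~ [/\ coxeter_edge M s t, coxeter_edge M t u & coxeter_edge M u s].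

Definition word_value (S : Type) (W : groupType) (gen : S -> W)
    (a : seq S) : W :=
  \prod_(s <- a) gen s.

Definition reduced_expression (S : Type) (W : groupType) (gen : S -> W)
    (a : seq S) (w : W) : Prop :=
  word_value gen a = w /\
  forall b : seq S, word_value gen b = w -> size a <= size b.

Section Braids.
Variables (S : finType) (M : coxeter_matrix S) (n : nat).
Implicit Types a b : n.-tuple S.

Definition braid_move : rel (n.-tuple S) := fun a b =>
  [exists i : 'I_n, exists s : S, exists t : S,
    [&& M s t == Some 3,
        tval a == take i a ++ [:: s; t; s] ++ drop (i + 3) a &
        tval b == take i a ++ [:: t; s; t] ++ drop (i + 3) a]].

Definition braid_class a : {set n.-tuple S} :=
  [set b | connect braid_move a b].

(* The interval [[i, i+2]] is represented by its left end i; positions are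
   numbered from 0. *)
Definition braid_shadow a (i : 'I_n) : bool :=
  [exists s : S, exists t : S,
    (M s t == Some 3) && prefix [:: s; t; s] (drop i a)].

Definition bs a : {set 'I_n} := [set i | braid_shadow a i].

Definition bs_class a : {set 'I_n} := \bigcup_(b in braid_class a) bs b.

Definition rank a : nat := #|bs_class a|.

Definition braid_vertex a : finType := {b : n.-tuple S | b \in braid_class a}.

Definition braid_graph a : rel (braid_vertex a) :=
  fun x y => braid_move (val x) (val y).

End Braids.

Arguments braid_graph {S} M {n} a.

Definition hypercube (r : nat) : rel (r.-tuple bool) :=
  fun x y => #|[set i : 'I_r | tnth x i != tnth y i]| == 1%N.

Definition connected_graph (T : finType) (e : rel T) : Prop :=
  forall x y, connect e x y.

Definition is_distance (T : finType) (e : rel T) (x y : T) (d : nat) : Prop :=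
  (exists p : seq T, [/\ path e x p, last x p = y & size p = d]) /\
  (forall p : seq T, path e x p -> last x p = y -> d <= size p).

Definition isometric_embedding (T U : finType) (e : rel T) (e' : rel U)
    (f : T -> U) : Prop :=
  connected_graph e /\
  forall x y d, is_distance e x y d <-> is_distance e' (f x) (f y) d.

Definition isometrically_embeds (T U : finType) (e : rel T) (e' : rel U) :
    Prop :=
  exists f : T -> U, isometric_embedding e e' f.

Definition partial_cube (T : finType) (e : rel T) : Prop :=
  exists r : nat, isometrically_embeds e (@hypercube r).

Definition isometric_dimension (T : finType) (e : rel T) (m : nat) : Prop :=
  isometrically_embeds e (@hypercube m) /\
  forall k, isometrically_embeds e (@hypercube k) -> m <= k.

Lemma braid_move_sym (S : finType) (M : coxeter_matrix S) (n : nat) :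
  symmetric (@braid_move S M n).
Proof.
suff H : forall a b, @braid_move S M n a b -> braid_move M b a.
  by move=> a b; apply/idP/idP; apply: H.
move=> a b /existsP[i /existsP[s /existsP[t]]].
case/and3P=> /eqP Mst /eqP Ha /eqP Hb.
have szi : size (take i a) = i by rewrite size_takel // size_tuple ltnW.
have Ti : take i b = take i a by rewrite Hb take_size_cat.
have Di : drop (i + 3) b = drop (i + 3) a.
  by rewrite {1}Hb catA drop_size_cat // size_cat szi.
apply/existsP; exists i; apply/existsP; exists t; apply/existsP; exists s.
by rewrite cox_sym Mst Ti Di -Ha -Hb !eqxx.
Qed.

Lemma braid_move_irr (S : finType) (M : coxeter_matrix S) (n : nat) :
  irreflexive (@braid_move S M n).
Proof.
move=> a; apply/negbTE/negP=> /existsP[i /existsP[s /existsP[t]]].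
case/and3P=> /eqP Mst /eqP Ha /eqP Hb.
move: Mst; have /eqP := etrans (esym Ha) Hb.
by rewrite eqseq_cat // eqxx /= => /eqP[-> _]; rewrite cox_diag.
Qed.

(* Main.v *)
Require Import Defs.
From HB Require Import structures.
From mathcomp Require Import all_boot.
From mathcomp Require Import all_fingroup all_algebra.
From mathcomp Require Import zify ring.
From Stdlib Require Import Classical_Prop.

(** Attach to a reduced word the sequence of its reflections
    s_1 ... s_(i-1) s_i s_(i-1) ... s_1, which are pairwise distinct.  A braid
    move at position i exchanges the reflections i and i + 2 around the center
    i + 1.  In the triangle-free case a position that is once a center is
    touched by no other braid shadow of the class, and the two reflections
    exchanged around it are always the same (rigidity, by induction on the
    length).  So a braid class is a set of orderings of the reflections that
    differ by reversals of a fixed family of triples, one for each element of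
    [bs_class], and any center belongs to one triple only.  Recording the
    orientation of each triple gives the map to the hypercube.  Given two words
    of the class, a triple with different orientations and of minimal span in
    the first word is consecutive there, hence is a braid shadow: reversing it
    brings the first word closer to the second, so that distances are Hamming
    distances. *)

Set Implicit Arguments.
Unset Strict Implicit.
Unset Printing Implicit Defensive.

(** * Orderings that differ by reversals of triples *)

Lemma window_nth (T : Type) (z : T) (l : seq T) i : i.+2 < size l ->
  l = take i l ++ [:: nth z l i; nth z l i.+1; nth z l i.+2] ++ drop i.+3 l.
Proof.
move=> lt; rewrite -{1}(cat_take_drop i l); congr (_ ++ _).
have [l0 l1] : i < size l /\ i.+1 < size l by split; lia.
by rewrite (drop_nth z l0) (drop_nth z l1) (drop_nth z lt).
Qed.

(** On the window from [n] to [n.+2] the map [sw] sends [i] to [n.+1.*2 - i], which reverses the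
    order; a point outside the window keeps its side of the whole window. *)
Lemma ltn_swap3 n k l
    (sw := fun i => if i == n then n.+2 else if i == n.+2 then n else i) :
  k <> l -> (sw k < sw l) =
    (k < l) (+) ((n <= k <= n.+2) && (n <= l <= n.+2)).
Proof.
have out i : ~~ (n <= i <= n.+2) -> sw i = i.
  by rewrite /sw; do 2?[case: eqP => [->|_]] => //; rewrite ?leqnn ?leqnSn ?(leqW (leqnSn _)).
have swE i : n <= i <= n.+2 -> sw i + i = n.+1.*2.
  by rewrite /sw; do 2?[case: eqP => [->|?]]; lia.
move: sw out swE => sw out swE nkl.
have [kin|kout] := boolP (n <= k <= n.+2); last first.
  rewrite addbF (out _ kout).
  have [lin|lout] := boolP (n <= l <= n.+2); last by rewrite (out _ lout).
  by have := swE _ lin; lia.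
have := swE _ kin; have [lin|lout] := boolP (n <= l <= n.+2).
  by have := swE _ lin; rewrite addbT; lia.
by rewrite addbF (out _ lout); lia.
Qed.

Section Triples.
Variables (T : eqType) (I : finType) (x c y : I -> T).

Definition triple i : seq T := [:: x i; c i; y i].

Hypothesis center_triple : forall i j, c i \in triple j -> i = j.
Hypothesis ends_triple :
  forall i j, x i \in triple j -> y i \in triple j -> i = j.

(** Two distinct points of a triple either include its center or are its two ends, and each
    hypothesis settles one case. So at most one triple governs the order of a given pair. *)
Lemma triple_pair p q i j : p != q ->
  p \in triple i -> q \in triple i -> p \in triple j -> q \in triple j -> i = j.
Proof.
move=> npq pi qi pj qj; have [ep|npc] := eqVneq p (c i).
  by apply: center_triple; rewrite -ep.
have [eq|nqc] := eqVneq q (c i); first by apply: center_triple; rewrite -eq.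
move: pi qi; rewrite !inE (negbTE npc) (negbTE nqc) /=.
move=> /orP[] /eqP ep /orP[] /eqP eq; move: npq; rewrite ep eq ?eqxx // => _;
  by apply: ends_triple; rewrite -?ep -?eq.
Qed.

(* A reversed triple of minimal span has nothing else between its ends: an
   intermediate [z] keeps its side of the center, hence crosses an end, and
   the triple responsible for this has smaller span. *)
Lemma minimal_reversed_triple (R : pred T) (f g : T -> nat) (H : {set I}) :
  {in R &, injective f} -> {in R &, injective g} ->
  (forall j, {subset triple j <= R}) ->
  (forall j, f (x j) < f (c j) < f (y j) \/ f (y j) < f (c j) < f (x j)) ->
  (forall j p q, j \in H -> p \in triple j -> q \in triple j -> p != q ->
     (f p < f q) = ~~ (g p < g q)) ->
  (forall p q, p \in R -> q \in R -> p != q ->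
     ~~ [exists j in H, (p \in triple j) && (q \in triple j)] ->
     (f p < f q) = (g p < g q)) ->
  H != set0 ->
  exists2 i, i \in H & forall z, z \in R -> z != c i ->
    ~ (f (x i) < f z < f (y i) \/ f (y i) < f z < f (x i)).
Proof.
move=> finj ginj subR betw rev same /set0Pn[i0 i0H].
pose span j := (f (x j) - f (y j)) + (f (y j) - f (x j)).
have [i iH imin] : exists2 i, i \in H & forall j, j \in H -> span i <= span j.
  by case: (arg_minnP span i0H) => i iH imin; exists i.
exists i => // z zR zc zbetw.
have mem3 j : [/\ x j \in triple j, c j \in triple j & y j \in triple j].
  by rewrite !inE !eqxx !orbT.
have [xi ci yi] := mem3 i; have bi := betw i.
have neqf p q : f p <> f q -> p != q by move=> ne; apply/eqP=> e; rewrite e in ne.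
have neqfR p q : p \in R -> q \in R -> p != q -> f p <> f q /\ g p <> g q.
  by move=> pR qR /eqP ne; split=> [/finj|/ginj] e; apply: ne; apply: e.
(* The only triple through [c i] is [triple i], so no reversal moves another point across [c i]. *)
have side w : w \in R -> w \notin triple i -> w != c i /\ (f w < f (c i)) = (g w < g (c i)).
  move=> wR wi; have ne : w != c i by apply: contraNneq wi => ->.
  split=> //; apply: same => //; first exact: subR ci.
  apply/exists_inP=> -[j _ /andP[wj cj]].
  by move: wi; rewrite (center_triple cj) wj.
have zi : z \notin triple i.
  rewrite !inE (negbTE zc) /= negb_or.
  by apply/andP; split; apply: neqf; clear -zbetw; lia.
have [_ zside] := side _ zR zi; have [fzc gzc] := neqfR _ _ zR (subR _ _ ci) zc.
(* [e] is the end on the same side of [c i] as [z], and [e'] is the opposite end. *)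
have [e [e' [ei e'i ee' ez]]] : exists e e',
    [/\ e \in triple i, e' \in triple i, (e, e') = (x i, y i) \/ (e, e') = (y i, x i) &
    f e < f z < f (c i) /\ f (c i) < f e' \/ f e' < f (c i) /\ f (c i) < f z < f e].
  case: (ltngtP (f z) (f (c i))) => [l|l|//];
  case: zbetw => b; by [exists (x i), (y i); split=> //; [left | clear -l b bi; lia]
    | exists (y i), (x i); split=> //; [right | clear -l b bi; lia]].
have nez : e != z by apply: neqf; clear -ez; lia.
have nec : e != c i by apply: neqf; clear -ez; lia.
have eR := subR _ _ ei; have [_ gez] := neqfR _ _ eR zR nez.
have [_ gec] := neqfR _ _ eR (subR _ _ ci) nec.
have rec := rev _ _ _ iH ei ci nec.
(* Passing to [g] carries [e] across [c i] but leaves [z] on its side, so [e] and [z] are exchanged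
   and must share a triple [j] of [H]. *)
have [/exists_inP[j jH /andP[ej zj]]|/same] :=
  boolP [exists j in H, (e \in triple j) && (z \in triple j)]; last first.
  by move/(_ eR zR nez)=> eqz; clear -eqz ez zside rec fzc gzc gez gec; lia.
have nij : i <> j by move=> ij; move: zi; rewrite ij zj.
have necj : e != c j.
  by apply/eqP=> ecj; apply: nij; apply/esym/center_triple; rewrite -ecj.
have [xj cj yj] := mem3 j; have bj := betw j.
have minj := imin _ jH; rewrite /span in minj.
have si : f e' + (f (x i) - f (y i)) + (f (y i) - f (x i)) = f e \/
          f e + (f (x i) - f (y i)) + (f (y i) - f (x i)) = f e'.
  by clear -ee' bi; case: ee' => -[-> ->]; lia.
have [r [rj er]] : exists r, r \in triple j /\ ((e, r) = (x j, y j) \/ (e, r) = (y j, x j)).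
  move: ej; rewrite !inE (negbTE necj) /= => /orP[]/eqP ->.
    by exists (y j); split=> //; left.
  by exists (x j); split=> //; right.
have bj' : f e < f (c j) < f r \/ f r < f (c j) < f e.
  by clear -er bj; case: er => -[-> ->]; lia.
have sj : f e + (f (x j) - f (y j)) + (f (y j) - f (x j)) = f r \/
          f r + (f (x j) - f (y j)) + (f (y j) - f (x j)) = f e.
  by clear -er bj; case: er => -[-> ->]; lia.
(* If [z] were an end of [j], the span of [j] would be smaller than that of [i]; so [z] is its
   center. *)
have [ezc|nzcj] := eqVneq z (c j); last first.
  have ezr : z = r.
    move: zj; rewrite !inE (negbTE nzcj) /=; case: er => -[e1 e2].
      by rewrite -e1 eq_sym (negbTE nez) /= => /eqP ->.
    by rewrite -e1 orbC eq_sym (negbTE nez) /= => /eqP ->.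
  by rewrite ezr in ez; clear -ez bj' si sj minj; lia.
(* Minimality of the span of [i] places [r] beyond [c i], where it stays under [g]; yet [j] reverses
   [z] and [r], which [c i] separates in both orders. *)
have rR := subR _ _ rj.
have ri : r \notin triple i.
  apply/negP=> ri; apply: nij; apply: (@triple_pair e r) => //.
  by apply: neqf; clear -bj'; lia.
have [nrc rside] := side _ rR ri.
have [frc grc] := neqfR _ _ rR (subR _ _ ci) nrc.
have nzr : z != r by rewrite ezc; apply: neqf; clear -bj'; lia.
have [fzr gzr] := neqfR _ _ zR rR nzr.
have rzr := rev _ _ _ jH zj rj nzr.
rewrite -ezc in bj'.
clear -ez bj' si sj minj zside rside rzr frc grc fzr gzr fzc gzc; lia.
Qed.

(** * Relative order of two entries and reversal of a window *)

Definition before (r : seq T) p q := index p r < index q r.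

Lemma index_swap3 (A B : seq T) a b d p : uniq (A ++ [:: a; d; b] ++ B) ->
  index p (A ++ [:: b; d; a] ++ B) =
  let k := index p (A ++ [:: a; d; b] ++ B) in
  if k == size A then (size A).+2 else if k == (size A).+2 then size A else k.
Proof.
rewrite cat_uniq /= !inE !negb_or.
move=> /and3P[_ _ /andP[/and3P[nad nab _] /andP[/andP[ndb _] _]]].
rewrite !index_cat /=; have [pA|_] := ifP.
  by move: pA; rewrite -index_mem => pA; do 2?[case: eqP => ?]; lia.
have [ep|_] := eqVneq a p; last have [ep|_] := eqVneq d p;
  last have [ep|_] := eqVneq b p.
all: try subst p; rewrite ?eqxx ?(eq_sym d a) ?(negbTE nad) ?(eq_sym b a).
all: rewrite ?(negbTE nab) ?(eq_sym b d) ?(negbTE ndb) /=.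
all: rewrite ?addn0 ?eqxx //; do ?[case: eqP => ?]; lia.
Qed.

Lemma mem3_index (A B : seq T) a b d p : uniq (A ++ [:: a; d; b] ++ B) ->
  (p \in [:: a; d; b]) =
    (size A <= index p (A ++ [:: a; d; b] ++ B) <= (size A).+2).
Proof.
move=> u; have pA : p \in [:: a; d; b] -> p \notin A.
  move: u; rewrite cat_uniq => /and3P[_ /hasPn nA _] pm; apply: nA.
  by rewrite mem_cat pm.
rewrite index_cat; case: ifP => [pA'|_].
  case: (boolP (p \in [:: _; _; _])) => [/pA|_]; first by rewrite pA'.
  by move: pA'; rewrite -index_mem; lia.
rewrite index_cat; case: ifP => [|_ /=]; last lia.
by rewrite -index_mem /=; lia.
Qed.

Lemma before_window (A B : seq T) a b d : uniq (A ++ [:: a; d; b] ++ B) ->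
  before (A ++ [:: a; d; b] ++ B) a d /\ before (A ++ [:: a; d; b] ++ B) d b.
Proof.
move=> u; have idx j : j < 3 ->
    index (nth a [:: a; d; b] j) (A ++ [:: a; d; b] ++ B) = size A + j.
  move=> lt; have -> : nth a [:: a; d; b] j = nth a (A ++ [:: a; d; b] ++ B) (size A + j).
    by rewrite nth_cat ltnNge leq_addr addKn nth_cat lt.
  by rewrite index_uniq // !size_cat /=; lia.
have := idx 0; have := idx 1; have := idx 2; rewrite /before /= => -> // -> // -> //.
lia.
Qed.

Lemma before_swap3 (A B : seq T) a b d p q : uniq (A ++ [:: a; d; b] ++ B) ->
  p \in A ++ [:: a; d; b] ++ B -> q \in A ++ [:: a; d; b] ++ B -> p != q ->
  before (A ++ [:: b; d; a] ++ B) p q =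
  before (A ++ [:: a; d; b] ++ B) p q (+)
    ((p \in [:: a; d; b]) && (q \in [:: a; d; b])).
Proof.
move=> u pin qin npq; rewrite /before 2?(@index_swap3 A B a b d) //.
rewrite 2?(@mem3_index A B a b d) //.
have : index p (A ++ [:: a; d; b] ++ B) <> index q (A ++ [:: a; d; b] ++ B).
  by move/(index_inj p pin qin) => e; rewrite e eqxx in npq.
exact: ltn_swap3.
Qed.

(** A sequence without repetition is sorted for its own [before], and a strict order admits only one
    sorted sequence with given elements. *)
Lemma before_eq (r1 r2 : seq T) : uniq r1 -> uniq r2 -> r1 =i r2 ->
  {in r1 &, forall p q, p != q -> before r1 p q = before r2 p q} -> r1 = r2.
Proof.
move=> u1 u2 e12 eqb.
have srt (r : seq T) : uniq r -> sorted (before r) r.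
  case: r => // z r u; apply/(sortedP z) => i lt.
  by rewrite /before !index_uniq // ltnW.
apply: (@irr_sorted_eq _ (before r1)) => //.
- by move=> a b d; apply: ltn_trans.
- by move=> a; apply: ltnn.
- exact: srt.
case: r2 u2 e12 eqb => // z r2 u2 e12 eqb; apply/(sortedP z) => i lt.
have in1 k : k < size (z :: r2) -> nth z (z :: r2) k \in r1.
  by move=> ltk; rewrite e12 mem_nth.
rewrite eqb ?in1 // 1?ltnW //; first by rewrite /before !index_uniq // ltnW.
by rewrite nth_uniq ?(ltnW lt) // neq_ltn ltnSn.
Qed.

(** * Orderings reached by successive reversals *)

Section Reachable.
Variable r0 : seq T.
Hypothesis r0_uniq : uniq r0.

(** The set holds the triples reversed an odd number of times, whence the symmetric difference with
    one index at each step. *)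
Inductive reachable : seq T -> {set I} -> Prop :=
  | reachable0 : reachable r0 set0
  | reachable_step A B a b i E :
      reachable (A ++ [:: a; c i; b] ++ B) E ->
      (a, b) = (x i, y i) \/ (a, b) = (y i, x i) ->
      reachable (A ++ [:: b; c i; a] ++ B) [set j | (j \in E) (+) (j == i)].

Lemma reachable_perm r E : reachable r E -> perm_eq r0 r.
Proof.
elim=> // A B a b i F _ pr _; apply: perm_trans pr _.
by rewrite perm_cat2l perm_cat2r -[[:: b; _; _]]/(rev [:: a; c i; b]) perm_sym perm_rev.
Qed.

Lemma reachable_uniq r E : reachable r E -> uniq r.
Proof. by move/reachable_perm/perm_uniq <-. Qed.

Lemma reachable_mem r E : reachable r E -> r =i r0.
Proof. by move/reachable_perm/perm_mem=> e z; rewrite e. Qed.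

Lemma exists_pair p q i (E : {set I}) :
  p != q -> p \in triple i -> q \in triple i ->
  [exists j in E, (p \in triple j) && (q \in triple j)] = (i \in E).
Proof.
move=> npq pi qi; apply/exists_inP/idP => [[j jE /andP[pj qj]]|iE].
  by rewrite (triple_pair npq pi qi pj qj).
by exists i => //; rewrite pi qi.
Qed.

(** A step changes the order of exactly the pairs inside its triple. By [triple_pair] only one index
    can affect a given pair, so the parities do not interfere. *)
Lemma reachable_before r E p q : reachable r E ->
  p \in r0 -> q \in r0 -> p != q ->
  before r p q = before r0 p q (+)
    [exists j in E, (p \in triple j) && (q \in triple j)].
Proof.
move=> rE pr qr npq; elim: rE => [|A B a b i F rF IH ab].
  rewrite (_ : [exists j in _, _] = false) ?addbF //.
  by apply/exists_inP=> -[j]; rewrite inE.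
rewrite before_swap3 ?(reachable_uniq rF) ?(reachable_mem rF) // {}IH -addbA.
congr (_ (+) _).
have emem z : (z \in [:: a; c i; b]) = (z \in triple i).
  case: ab => -[-> ->] //; rewrite !inE.
  by case: (z == y i); case: (z == c i); case: (z == x i).
rewrite !emem; have [/andP[pi qi]|npqi] := boolP ((p \in triple i) && (q \in triple i)).
  by rewrite !(exists_pair _ npq pi qi) !inE eqxx.
rewrite addbF; apply: eq_existsb => j; rewrite in_set.
have [->|_] := eqVneq j i; last by rewrite addbF.
by rewrite (negbTE npqi) !andbF.
Qed.

Lemma reachable_before2 r1 r2 E1 E2 p q : reachable r1 E1 -> reachable r2 E2 ->
  p \in r0 -> q \in r0 -> p != q ->
  before r1 p q (+) before r2 p q =
    [exists j in [set j | (j \in E1) != (j \in E2)],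
       (p \in triple j) && (q \in triple j)].
Proof.
move=> rE1 rE2 pr qr npq.
rewrite (reachable_before rE1) // (reachable_before rE2) //.
rewrite addbACA addbb /=.
have [/existsP[i /andP[pi qi]]|nex] :=
    boolP [exists j, (p \in triple j) && (q \in triple j)].
  by rewrite !(exists_pair _ npq pi qi) inE; do 2!case: (_ \in _).
have none (E : {set I}) : [exists j in E, (p \in triple j) && (q \in triple j)] = false.
  by apply: contraNF nex => /exists_inP[j _ pq]; apply/existsP; exists j.
by rewrite !none.
Qed.

Lemma reachable_bit r E i : reachable r E ->
  x i \in r0 -> y i \in r0 -> x i != y i ->
  (i \in E) = before r (x i) (y i) (+) before r0 (x i) (y i).
Proof.
move=> rE xr yr nxy; rewrite (reachable_before rE) //.
rewrite (@exists_pair _ _ i) ?inE ?eqxx ?orbT //.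
by rewrite addbC addbA addbb.
Qed.

(** The pairs formed by [c i] with either end lie in no triple but that of [i], so from [r1] to [r2]
    both are exchanged or neither is. *)
Lemma reachable_between r1 r2 E1 E2 i : reachable r1 E1 -> reachable r2 E2 ->
  {subset triple i <= r0} -> before r1 (x i) (c i) -> before r1 (c i) (y i) ->
  before r2 (x i) (c i) && before r2 (c i) (y i) \/
  before r2 (y i) (c i) && before r2 (c i) (x i).
Proof.
move=> rE1 rE2 sub xc cy.
have [xi ci yi] : [/\ x i \in triple i, c i \in triple i & y i \in triple i].
  by rewrite !inE !eqxx !orbT.
have nxc : x i != c i by apply/eqP=> e; rewrite e /before ltnn in xc.
have ncy : c i != y i by apply/eqP=> e; rewrite e /before ltnn in cy.
have swap p q : p \in r0 -> q \in r0 -> p != q -> before r2 p q = ~~ before r2 q p.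
  move=> pr qr npq; rewrite /before -leqNgt [RHS]leq_eqVlt orbC.
  case: eqP => [e|_]; last by rewrite orbF.
  by move: npq; rewrite (index_inj p _ _ e) ?(reachable_mem rE2) ?eqxx.
have := reachable_before2 rE1 rE2 (sub _ xi) (sub _ ci) nxc.
have := reachable_before2 rE1 rE2 (sub _ ci) (sub _ yi) ncy.
rewrite (exists_pair _ nxc xi ci) (exists_pair _ ncy ci yi) xc cy.
rewrite (swap (y i) (c i) (sub _ yi) (sub _ ci)) 1?eq_sym //.
rewrite (swap (c i) (x i) (sub _ ci) (sub _ xi)) 1?eq_sym //.
case: (i \in _); case: (before r2 (c i) (y i)); case: (before r2 (x i) (c i)) => //= _ _;
  by [left|right].
Qed.

End Reachable.

End Triples.

(** * Embeddings in the hypercube *)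

Section Hypercube.
Variable r : nat.
Implicit Types u v w : r.-tuple bool.

Definition hamming u v := #|[set i | tnth u i != tnth v i]|.

Lemma hamming_triangle v u w : hamming u w <= hamming u v + hamming v w.
Proof.
rewrite /hamming -cardsUI; apply: leq_trans (leq_addr _ _).
apply/subset_leq_card/subsetP => i; rewrite !inE.
by case: (tnth u i) (tnth v i) (tnth w i) => [] [] [].
Qed.

Lemma hamming_path u p : path (@hypercube r) u p -> hamming u (last u p) <= size p.
Proof.
elim: p u => [|v p IH] u /=.
  by move=> _; rewrite /hamming leqn0 cards_eq0; apply/eqP/setP=> i; rewrite !inE eqxx.
move=> /andP[/eqP uv /IH le].
by apply: leq_trans (hamming_triangle v _ _) _; rewrite /hamming uv add1n.
Qed.

(** Repeated descent gives a path no longer than the Hamming distance, and no path is shorter, as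
    each edge changes one coordinate. *)
Lemma isometric_of_descent (T : finType) (e : rel T) (f : T -> r.-tuple bool) :
  (forall x y, e x y -> hypercube (f x) (f y)) ->
  (forall x y, x != y -> exists2 z, e x z & hamming (f z) (f y) < hamming (f x) (f y)) ->
  isometric_embedding e (@hypercube r) f.
Proof.
move=> fe desc.
have fpath x p : path e x p -> path (@hypercube r) (f x) (map f p).
  by move=> pp; apply: homo_path pp.
have geo x y : exists p, [/\ path e x p, last x p = y & size p = hamming (f x) (f y)].
  suff [p [pp lp sp]] : exists p,
      [/\ path e x p, last x p = y & size p <= hamming (f x) (f y)].
    exists p; split=> //; apply/eqP; rewrite eqn_leq sp /=.
    by have := hamming_path (fpath _ _ pp); rewrite last_map size_map lp.
  have [m] := ubnP (hamming (f x) (f y)); elim: m x => // m IH x lt.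
  have [->|/desc[z xz ltz]] := eqVneq x y; first by exists [::].
  have [|p [pp lp sp]] := IH z; first by lia.
  by exists (z :: p); split; rewrite //= ?xz //; lia.
split=> [x y|x y d].
  by have [p [pp lp _]] := geo x y; apply/connectP; exists p.
have [p [pp lp sp]] := geo x y.
have dx q : path e x q -> last x q = y -> hamming (f x) (f y) <= size q.
  move=> pq lq.
  by have := hamming_path (fpath _ _ pq); rewrite last_map size_map lq.
have dfx q : path (@hypercube r) (f x) q -> last (f x) q = f y ->
    hamming (f x) (f y) <= size q.
  by move=> /hamming_path le lq; rewrite lq in le.
(* The image of the path found in [T] serves as a geodesic of the hypercube. *)
have dfy : path (@hypercube r) (f x) (map f p) /\ last (f x) (map f p) = f y.
  by split; [apply: fpath | rewrite last_map lp].
split=> -[[q [pq lq sq]] mq].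
  have {sq} -> : d = hamming (f x) (f y).
    by apply/eqP; rewrite eqn_leq -{2}sq dx // andbT -sp; apply: mq.
  split; last exact: dfx.
  by case: dfy => ? ?; exists (map f p); rewrite size_map.
have {sq} -> : d = hamming (f x) (f y).
  case: dfy => pf lf.
  by apply/eqP; rewrite eqn_leq -{2}sq dfx // andbT -sp -(size_map f); apply: mq.
by split; [exists p | exact: dx].
Qed.

End Hypercube.

Lemma isometric_dimension_exists (T : finType) (e : rel T) (r : nat) :
  isometrically_embeds e (@hypercube r) ->
  exists2 d, isometric_dimension e d & d <= r.
Proof.
have [m] := ubnP r; elim: m r => // m IH r ltm emb.
(* Excluded middle decides whether a smaller hypercube suffices; the induction on the bound then
   reaches the least one. *)
have [[k ltk embk]|nex] :=
  classic (exists2 k, k < r & isometrically_embeds e (@hypercube k)).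
  have [|d dd ld] := IH k _ embk; first by lia.
  by exists d => //; lia.
exists r => //; split=> // k embk; rewrite leqNgt; apply/negP=> ltk.
by apply: nex; exists k.
Qed.

(** * Injectivity of the Coxeter generators *)

Section Representation.
Import GRing.Theory.
Local Open Scope ring_scope.
Variables (R : finComNzRingType) (S : finType) (M : coxeter_matrix S).
Implicit Types (s t : S) (f : {ffun S -> R}).

(* The contragredient of the geometric representation,
   over a finite ring so that it lands in a permutation group. *)
Definition gen_act s f : {ffun S -> R} :=
  [ffun t => if t == s then - f s
             else if M s t == Some 3 then f t + f s else f t].

Lemma gen_actK s : involutive (gen_act s).
Proof.
move=> f; apply/ffunP=> t; rewrite !ffunE eqxx.
have [->|_] := eqVneq t s; first by rewrite opprK.
by case: (M s t == Some 3) => /=; ring.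
Qed.

Definition gen_perm s : {perm {ffun S -> R}} := perm (inv_inj (gen_actK s)).

(** The exponent is 1, 2 or 3, and the relation is checked at each coordinate: at [s], at [t], and
    at any other [u] according to its adjacency to each of them. *)
Lemma gen_perm_relations : simply_laced M -> coxeter_relations M gen_perm.
Proof.
move=> sl s t k mst; have [k' mst' k'3] := sl s t.
move: mst'; rewrite mst => -[ek]; subst k'.
apply/permP=> f; rewrite perm1.
have [ets|nst] := eqVneq s t.
  subst t; move: mst; rewrite cox_diag => -[<-].
  by rewrite expg1 permM !permE gen_actK.
have k2 := cox_offdiag nst mst.
have mts : M t s = Some k by rewrite cox_sym.
have nts : t != s by rewrite eq_sym.
case: k => [|[|[|[|//]]]] // in mst mts k2 k'3 *.
  rewrite expgS expg1 !permM !permE; apply/ffunP=> u; rewrite !ffunE !eqxx.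
  rewrite ?(negbTE nst) ?(negbTE nts) ?mst ?mts /=.
  have [->|nus] := eqVneq u s; first by rewrite ?(negbTE nst) ?mst ?mts /=; ring.
  have [->|nut] := eqVneq u t; first by rewrite ?(negbTE nts) ?mst ?mts /=; ring.
  by case: (M s u == Some 3); case: (M t u == Some 3); ring.
rewrite 2!expgS expg1 !permM !permE; apply/ffunP=> u; rewrite !ffunE !eqxx.
rewrite ?(negbTE nst) ?(negbTE nts) ?mst ?mts /=.
have [->|nus] := eqVneq u s; first by rewrite ?(negbTE nst) ?mst ?mts /=; ring.
have [->|nut] := eqVneq u t; first by rewrite ?(negbTE nts) ?mst ?mts /=; ring.
by case: (M s u == Some 3); case: (M t u == Some 3); ring.
Qed.

(** On the indicator of [s], the coordinate [s] becomes [-1] under [gen_perm s] and stays [1] under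
    [gen_perm t] when [t != s]. *)
Lemma gen_perm_inj : -1 != 1 :> R -> injective gen_perm.
Proof.
move=> neq11 s t est; apply/eqP; apply: contraT => nst.
pose d : {ffun S -> R} := [ffun u => (u == s)%:R].
have := congr1 (fun g : {perm _} => g d s) est.
rewrite !permE !ffunE eqxx (negbTE nst) (eq_sym t s) (negbTE nst) addr0.
by case: ifP => _ /= e; rewrite e eqxx in neq11.
Qed.

End Representation.

(** The universal property maps [W] to the permutations above; ['F_3] is chosen for being finite
    with [-1 != 1]. *)
Lemma coxeter_gen_inj (S : finType) (M : coxeter_matrix S) (W : groupType)
    (gen : S -> W) :
  simply_laced M -> coxeter_system M gen -> injective gen.
Proof.
move=> sl [_ univ] s t est.
have [[phi ephi] _] := univ _ _ (@gen_perm_relations 'F_3 _ M sl).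
by apply: (@gen_perm_inj 'F_3 _ M) => //; rewrite -!ephi est.
Qed.

Local Open Scope group_scope.

(** * Braid equivalence and reduced words *)

Lemma cat_eq_cat (T : Type) (p x u y : seq T) :
  size p <= size u -> p ++ x = u ++ y -> exists2 z, u = p ++ z & x = z ++ y.
Proof.
elim: p u => [|a p IH] [|b u] //=; first by move=> _ ->; exists [::].
  by move=> _ ->; exists (b :: u).
rewrite ltnS => le [-> /(IH _ le)[z -> ->]]; by exists z.
Qed.

Section BraidEquivalence.
Variables (S : finType) (M : coxeter_matrix S).
Implicit Types (s t : S) (a b p q u v : seq S).

(** Words are freed from a fixed length, so that equivalences can be applied to the factors of a
    word. *)
Definition bmove a b : Prop :=
  exists p s t q,
    [/\ M s t = Some 3, a = p ++ [:: s; t; s] ++ q & b = p ++ [:: t; s; t] ++ q].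

Inductive beq a : seq S -> Prop :=
  | beq_refl : beq a a
  | beq_step b c : beq a b -> bmove b c -> beq a c.

Lemma bmove_sym a b : bmove a b -> bmove b a.
Proof.
by case=> p [s [t [q [m -> ->]]]]; exists p, t, s, q; split; rewrite // cox_sym.
Qed.

Lemma beq_trans b a c : beq a b -> beq b c -> beq a c.
Proof. by move=> ab; elim=> // d e _ ad de; apply: beq_step ad de. Qed.

Lemma beq1 a b : bmove a b -> beq a b.
Proof. by apply: beq_step; apply: beq_refl. Qed.

Lemma beq_sym a b : beq a b -> beq b a.
Proof.
elim=> [|c d _ ca cd]; first exact: beq_refl.
exact: beq_trans (beq1 (bmove_sym cd)) ca.
Qed.

Lemma beq_cat u u' v v' : beq u u' -> beq v v' -> beq (u ++ v) (u' ++ v').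
Proof.
move=> uu' vv'; apply: (@beq_trans (u' ++ v)).
  elim: uu' => [|b c _ IH [p [s [t [q [m eb ec]]]]]]; first exact: beq_refl.
  apply: (beq_step IH); exists p, s, t, (q ++ v).
  by rewrite eb ec -!catA.
elim: vv' => [|b c _ IH [p [s [t [q [m eb ec]]]]]]; first exact: beq_refl.
apply: (beq_step IH); exists (u' ++ p), s, t, q.
by rewrite eb ec -!catA.
Qed.

Lemma bmove_size a b : bmove a b -> size a = size b.
Proof. by case=> p [s [t [q [_ -> ->]]]]; rewrite !size_cat. Qed.

Lemma beq_size a b : beq a b -> size a = size b.
Proof. by elim=> // c d _ -> /bmove_size. Qed.

Lemma beq_rev a b : beq a b -> beq (rev a) (rev b).
Proof.
elim=> [|c d _ IH [p [s [t [q [m ec ed]]]]]]; first exact: beq_refl.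
apply: (beq_step IH); exists (rev q), s, t, (rev p).
by rewrite ec ed !rev_cat -!catA.
Qed.

End BraidEquivalence.

Section ReducedWords.
Variables (S : finType) (M : coxeter_matrix S) (W : groupType) (gen : S -> W).
Hypothesis gen2 : forall s, gen s * gen s = 1.
Hypothesis gen3 : forall s t, M s t = Some 3 ->
  gen s * gen t * gen s = gen t * gen s * gen t.
Implicit Types (s t : S) (a b p q u v : seq S).

Local Notation val := (word_value gen).
Local Notation beq := (beq M).

Definition reduced a : Prop := forall b, val b = val a -> size a <= size b.

Lemma val_nil : val [::] = 1.
Proof. exact: big_nil. Qed.

Lemma val_cons s a : val (s :: a) = gen s * val a.
Proof. exact: big_cons. Qed.

Lemma val_cat a b : val (a ++ b) = val a * val b.
Proof. exact: big_cat. Qed.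

Lemma val_rcons a s : val (rcons a s) = val a * gen s.
Proof. by rewrite -cats1 val_cat val_cons val_nil mulg1. Qed.

Lemma genV s : (gen s)^-1 = gen s.
Proof. by rewrite -[RHS](mulKg (gen s)) gen2 mulg1. Qed.

Lemma val_rev a : val (rev a) = (val a)^-1.
Proof.
elim: a => [|s a IH]; first by rewrite val_nil invg1.
by rewrite rev_cons val_rcons IH val_cons invgM genV.
Qed.

Lemma val_braid s t : M s t = Some 3 -> val [:: s; t; s] = val [:: t; s; t].
Proof. by move/gen3=> e; rewrite !val_cons val_nil !mulg1 !mulgA. Qed.

Lemma beq_val a b : beq a b -> val a = val b.
Proof.
elim=> // c d _ -> [p [s [t [q [m -> ->]]]]].
by rewrite !val_cat val_braid.
Qed.

Lemma reduced_beq a b : beq a b -> reduced a -> reduced b.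
Proof.
by move=> ab ra c; rewrite -(beq_val ab) -(beq_size ab) => /ra.
Qed.

Lemma reduced_cat u v : reduced (u ++ v) -> reduced u /\ reduced v.
Proof.
move=> r; split=> b eb.
  have := r (b ++ v); rewrite !val_cat eb !size_cat leq_add2r; exact.
have := r (u ++ b); rewrite !val_cat eb !size_cat leq_add2l; exact.
Qed.

Lemma reduced_rev a : reduced a -> reduced (rev a).
Proof.
move=> r b eb; rewrite size_rev -(size_rev b); apply: r.
by rewrite val_rev eb val_rev invgK.
Qed.

(** [stst = tstt = ts] saves two letters. *)
Lemma stst_not_reduced p s t q :
  M s t = Some 3 -> ~ reduced (p ++ [:: s; t; s; t] ++ q).
Proof.
move=> m /(_ (p ++ [:: t; s] ++ q)).
rewrite (_ : [:: s; t; s; t] = [:: s; t; s] ++ [:: t]) //.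
rewrite !val_cat val_braid // !val_cons val_nil !mulg1 !size_cat /=.
rewrite -!mulgA (mulgA (gen t) (gen t)) gen2 mul1g => /(_ erefl); lia.
Qed.

Lemma ss_not_reduced p s q : ~ reduced (p ++ [:: s; s] ++ q).
Proof.
move=> /(_ (p ++ q)).
rewrite !val_cat !val_cons val_nil !mulg1 gen2 mul1g !size_cat /=.
move=> /(_ erefl); lia.
Qed.

(* The reflection g s g^-1 of the letter s after a prefix of value g is written
   [gen s ^ k] with [k := g^-1], so that the next parameter is [gen s * k]. *)
Fixpoint refls (k : W) a : seq W :=
  if a is s :: b then gen s ^ k :: refls (gen s * k) b else [::].

Lemma size_refls k a : size (refls k a) = size a.
Proof. by elim: a k => //= s a IH k; rewrite IH. Qed.

Lemma refls_cat k a b :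
  refls k (a ++ b) = refls k a ++ refls ((val a)^-1 * k) b.
Proof.
elim: a k => [|s a IH] k /=; first by rewrite val_nil invg1 mul1g.
by rewrite IH val_cons invgM genV mulgA.
Qed.

(** Multiplying on the left by the reflection of a letter deletes that letter; conjugation by [k^-1]
    undoes the initial parameter. *)
Lemma refls_exchange r k a : r \in refls k a ->
  exists2 b, size a = (size b).+1 & r ^ k^-1 * val a = val b.
Proof.
elim: a k => //= s a IH k; rewrite inE => /predU1P[->|/IH[b sb eb]].
  by exists a; rewrite // conjgK val_cons mulgA gen2 mul1g.
exists (s :: b); rewrite /= ?sb // !val_cons -eb invgM genV conjgM.
by rewrite [RHS]mulgA -conjgC mulgA.
Qed.

(** If the reflection of the first letter came back, [refls_exchange] would delete a letter of the
    tail as well, and the word would equal one shorter by two. *)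
Lemma refls_uniq k a : reduced a -> uniq (refls k a).
Proof.
elim: a k => //= s a IH k r.
have [_ ra] := @reduced_cat [:: s] a r.
rewrite IH // andbT; apply/negP=> /refls_exchange[b sb].
rewrite invgM genV conjgM conjgK conjgE genV gen2 mulg1 -val_cons => /esym/r /=.
lia.
Qed.

(** [h] is the parameter at the middle letter; it serves the first letter too, since a generator
    commutes with itself. *)
Lemma refls_window k p s t q (h := gen s * ((val p)^-1 * k)) :
  refls k (p ++ [:: s; t; s] ++ q) =
  refls k p ++ [:: gen s ^ h; gen t ^ h; (gen s ^ h) ^ (gen t ^ h)] ++
    refls ((val (p ++ [:: s; t; s]))^-1 * k) q.
Proof.
rewrite catA refls_cat refls_cat -catA; congr (_ ++ (_ ++ _)).
rewrite /= -/h; congr [:: _; _; _].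
  by rewrite /h [RHS]conjgM [gen s ^ gen s]conjgE mulKg.
by rewrite conjgM conjJg.
Qed.

(** * Rigidity of braid shadows *)

Hypothesis no_triangle : forall s t r,
  M s t = Some 3 -> M s r = Some 3 -> M t r <> Some 3.

Lemma M_diag3 s : M s s <> Some 3.
Proof. by rewrite cox_diag. Qed.

(* A shadow that touches the center of an equivalent word's shadow occupies the
   same positions and uses the same two letters. *)
Definition rigid n : Prop :=
  forall p s t q p' s' t' q',
    size (p ++ [:: s; t; s] ++ q) = n -> reduced (p ++ [:: s; t; s] ++ q) ->
    M s t = Some 3 -> M s' t' = Some 3 ->
    beq (p ++ [:: s; t; s] ++ q) (p' ++ [:: s'; t'; s'] ++ q') ->
    size p' <= (size p).+1 <= (size p').+2 ->
    size p' = size p /\ (s' = s /\ t' = t \/ s' = t /\ t' = s).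

(** The last letter changes only through a shadow at the end of the word. After a change from [t] to
    [z], some equivalent word ends in [t z t]; by rigidity the next such shadow uses the same two
    letters, so it brings [t] back. *)
Lemma rigid_last u t u' t' :
  rigid (size u).+1 -> reduced (rcons u t) -> beq (rcons u t) (rcons u' t') ->
  t' = t \/ M t t' = Some 3.
Proof.
move=> rig red bequ.
suff H b : beq (rcons u t) b -> exists2 v, exists r, b = rcons v r &
    last t b = t \/ M t (last t b) = Some 3 /\
      exists p, beq (rcons u t) (p ++ [:: t; last t b; t]).
  by case: (H _ bequ) => _ _; rewrite last_rcons; case=> [->|[]]; [left|right].
elim=> [|{bequ}b c bequ [_ _ IH] [p [s [r [q [m eb ec]]]]]].
  by exists u; [exists t|rewrite last_rcons; left].
case/lastP: q => [|q z] in eb ec.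
  exists (p ++ [:: r; s]); first by exists r; rewrite -cats1 -catA.
  have lb : last t b = s by rewrite eb !last_cat.
  have -> : last t c = r by rewrite ec !last_cat.
  rewrite lb {lb} in IH; case: IH => [est|[mts [p0 bp0]]].
    by subst s; right; split=> //; exists p; rewrite eb cats0 in bequ.
  have szu := beq_size bp0; rewrite size_rcons size_cat /= in szu.
  have szb := beq_size bequ; rewrite eb size_rcons size_cat /= in szb.
  have [] := rig p0 t s [::] p s r [::]; rewrite ?cats0 //.
  - by rewrite size_cat -szu.
  - exact: reduced_beq bp0 red.
  - by rewrite cats0 in eb; rewrite -eb; apply: beq_trans (beq_sym bp0) bequ.
  - lia.
  by move=> _ [[est _]|[_ ->]]; [subst s; case: (M_diag3 mts)|left].
exists (p ++ [:: r; s; r] ++ q).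
  by exists z; rewrite ec -!cats1 -!catA.
have -> : last t c = last t b by rewrite ec eb !last_cat !last_rcons.
exact: IH.
Qed.

Lemma rigid_first v t v' t' :
  rigid (size v).+1 -> reduced (t :: v) -> beq (t :: v) (t' :: v') ->
  t' = t \/ M t t' = Some 3.
Proof.
move=> rig red bev; apply: (@rigid_last (rev v) t (rev v') t').
- by rewrite size_rev.
- by rewrite -rev_cons; apply: reduced_rev.
by rewrite -!rev_cons; apply: beq_rev.
Qed.

(* Between two uses of the center [s], the moves act separately on its left
   and on its right. *)
Lemma rigid_separated u t s v u' v' p s' t' q :
  (forall m, m < size (u ++ [:: t; s; t] ++ v) -> rigid m) ->
  reduced (u ++ [:: t; s; t] ++ v) ->
  M s t = Some 3 -> M s' t' = Some 3 ->
  beq (rcons u t) u' -> beq (t :: v) v' ->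
  u' ++ s :: v' = p ++ [:: s'; t'; s'] ++ q ->
  size p <= size u' <= (size p).+2 ->
  [/\ u' = rcons p t, v' = t :: q, s' = t & t' = s].
Proof.
move=> IH red mst mst' bu bv e szp.
have szu := beq_size bu; rewrite size_rcons in szu.
have szv := beq_size bv; rewrite /= in szv.
have ea : u ++ [:: t; s; t] ++ v = rcons u t ++ s :: t :: v.
  by rewrite -cats1 -catA.
have [ru rv] : reduced (rcons u t) /\ reduced (t :: v).
  split; first by move: red; rewrite ea => /reduced_cat[].
  by move: red; rewrite (catA u [:: t; s] (t :: v)) => /reduced_cat[].
have rigu : rigid (size u).+1 by apply: IH; rewrite !size_cat /=; lia.
have rigv : rigid (size v).+1 by apply: IH; rewrite !size_cat /=; lia.
(* This is where triangles are excluded: [r], [s] and [t] would form one. *)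
have adj r : r = t \/ M t r = Some 3 -> M s r = Some 3 -> r = t.
  by case=> // mtr msr; case: (no_triangle mst msr).
have [z eu ez] : exists2 z, u' = p ++ z & [:: s'; t'; s'] ++ q = z ++ s :: v'.
  by apply: cat_eq_cat; [lia | rewrite e].
have szz : size z <= 2 by rewrite eu size_cat in szp; lia.
(* [z] is the part of the shadow to the left of the center. If it has 0 or 2 letters, the shadow
   starts or ends at the center, and an equivalent word contains [tsts] or [stst]; only 1
   remains. *)
case: z => [|z1 [|z2 [|//]]] in eu ez szz.
- move: ez => /= [es' ev']; subst s' v'.
  have et' : t' = t.
    by apply: adj => //; exact: rigid_first rigv rv bv.
  subst t'; exfalso; apply: (@stst_not_reduced u t s q); first by rewrite cox_sym.
  apply: (@reduced_beq (u ++ [:: t; s; t] ++ v)) => //.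
  rewrite ea (_ : u ++ _ ++ q = rcons u t ++ s :: t :: s :: q).
    apply: beq_cat; first exact: beq_refl.
    by apply: (@beq_cat _ _ [:: s] [:: s]); first exact: beq_refl.
  by rewrite -cats1 -catA.
- move: ez => /= [e1 e2 e3]; subst z1 t' v'.
  have es' : s' = t.
    apply: adj; last by rewrite cox_sym.
    by apply: (@rigid_last u t p) => //; rewrite -[rcons p s']cats1 -eu.
  by subst s'; rewrite eu cats1.
move: ez => /= [e1 e2 e3 e4]; subst z1 z2 s' v'.
have et' : t' = t.
  apply: adj => //.
  apply: (@rigid_last u t (rcons p s) t') => //.
  by rewrite -[rcons _ t']cats1 -[rcons p s]cats1 -catA -eu.
subst t'; exfalso; apply: (@stst_not_reduced p s t v) => //.
apply: (@reduced_beq (u ++ [:: t; s; t] ++ v)) => //.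
rewrite ea (_ : p ++ _ ++ v = u' ++ s :: t :: v); last by rewrite eu -catA.
by apply: beq_cat => //; apply: beq_refl.
Qed.

(* The invariant of a walk in the braid class of [a], whose shadow at [size p0]
   has center [s0]: since the last move at this shadow, which left the word
   [u ++ [:: t; s; t] ++ v], the center [s] has not been touched. *)
Definition center_split p0 t0 s0 (a b : seq S) : Prop :=
  exists u t s v u' v',
    [/\ M s t = Some 3, beq a (u ++ [:: t; s; t] ++ v) & size u = size p0] /\
    [/\ beq (rcons u t) u', beq (t :: v) v' & b = u' ++ s :: v'] /\
    let h := (val u')^-1 in let h0 := (val (rcons p0 t0))^-1 in
    [/\ t = t0 /\ s = s0 \/ t = s0 /\ s = t0,
        gen s ^ h = gen s0 ^ h0 &
        gen t ^ h = gen t0 ^ h0 \/ gen t ^ h = (gen t0 ^ h0) ^ (gen s0 ^ h0)].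

Lemma gen_conj2 s k x : (x ^ (gen s ^ k)) ^ (gen s ^ k) = x.
Proof. by rewrite -conjgM -conjMg gen2 conj1g conjg1. Qed.

(** By [rigid_separated], a move that touches the center is centered there and swaps the two
    letters. Any other move takes place inside [u'] or inside [v'] and preserves the value of
    [u']. *)
Lemma center_splitP p0 t0 s0 q0 b (a := p0 ++ [:: t0; s0; t0] ++ q0) :
  (forall m, m < size a -> rigid m) -> reduced a -> M s0 t0 = Some 3 ->
  beq a b -> center_split p0 t0 s0 a b.
Proof.
move=> IH red m0; elim=> [|{}b c bab].
  exists p0, t0, s0, q0, (rcons p0 t0), (t0 :: q0).
  split; [by split=> //; exact: beq_refl | split; last by split=> //; left].
  by split; rewrite -?cats1 -?catA //; exact: beq_refl.
move=> [u [t [s [v [u' [v' [[mst bau szu] [[bu bv eb] [lets cen ends]]]]]]]]].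
move=> [p [s' [t' [q [m e ec]]]]]; rewrite e in eb; move/esym: eb => eb.
have [touch|Ntouch] := boolP (size p <= size u' <= (size p).+2).
  have [|eu ev es et] := rigid_separated _ (reduced_beq bau red) mst m bu bv eb touch.
    by move=> k; rewrite -(beq_size bau); apply: IH.
  subst s' t'; exists p, s, t, q, (rcons p s), (s :: q); split.
    split=> //.
    - apply: (beq_step bab); rewrite e.
      by exists p, t, s, q; split.
    - by move: (beq_size bu); rewrite eu !size_rcons szu => -[].
  split; first by split; rewrite ?ec -?cats1 -?catA //; exact: beq_refl.
  (* The parameter after the new left factor is the old one multiplied by [st]; by the braid
     relation this fixes the reflection of the center and conjugates that of the end by it. *)
  have ek : (val (rcons p s))^-1 = gen s * gen t * (val u')^-1.
    by rewrite eu !val_rcons !invgM !genV -mulgA (mulgA (gen t) (gen t)) gen2 mul1g.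
  have es : gen t ^ (val (rcons p s))^-1 = gen s ^ (val u')^-1.
    rewrite ek conjgM; congr (_ ^ _).
    rewrite conjgM !conjgE !genV !mulgA gen3 1?cox_sym //.
    by rewrite -!mulgA (mulgA (gen s) (gen s)) gen2 mul1g gen2 mulg1.
  have et : gen s ^ (val (rcons p s))^-1 =
            (gen t ^ (val u')^-1) ^ (gen s ^ (val u')^-1).
    rewrite ek conjgM -conjJg; congr (_ ^ _).
    rewrite conjgM [_ ^ gen s]conjgE mulKg !conjgE !genV !mulgA.
    by rewrite gen3 1?cox_sym.
  split=> /=.
  - by case: lets => -[-> ->]; [right|left].
  - by rewrite es.
  - rewrite et cen; case: ends => ->; first by right.
    by left; rewrite gen_conj2.
have [ltu|leu] := ltnP (size u') (size p).
  have [z ep ez] : exists2 z, p = (u' ++ [:: s]) ++ z &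
      v' = z ++ [:: s'; t'; s'] ++ q.
    by apply: cat_eq_cat; [rewrite size_cat /= addn1 | rewrite -catA].
  exists u, t, s, v, u', (z ++ [:: t'; s'; t'] ++ q).
  split=> //; split; last by split.
  split=> //.
    by apply: (beq_step bv); rewrite ez; exists z, s', t', q.
  by rewrite ec ep -!catA.
have [z eu ez] : exists2 z, u' = (p ++ [:: s'; t'; s']) ++ z & q = z ++ s :: v'.
  by apply: cat_eq_cat; [rewrite size_cat /=; lia | rewrite -catA].
have bu2 : beq (rcons u t) (p ++ [:: t'; s'; t'] ++ z).
  apply: (beq_step bu); exists p, s', t', z; split=> //.
  by rewrite eu -catA.
exists u, t, s, v, (p ++ [:: t'; s'; t'] ++ z), v'.
split=> //; split; first by split=> //; rewrite ec ez -!catA.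
by rewrite -(beq_val bu2) (beq_val bu); split.
Qed.

(** Strong induction on the length: splitting the second word around the center leads to
    [rigid_separated], which calls on rigidity for shorter words only. *)
Lemma rigidP n : rigid n.
Proof.
elim/ltn_ind: n => n IH p s t q p' s' t' q' en red mst mst' bb szp.
have mts : M t s = Some 3 by rewrite cox_sym.
have := center_splitP _ red mts bb; rewrite en => /(_ IH).
move=> [u [r [z [v [u' [v' [[mzr bau szu] [[bu bv eb] [lets _ _]]]]]]]]].
have szu' := beq_size bu; rewrite size_rcons szu in szu'.
have [||eu ev es et] :=
  rigid_separated _ (reduced_beq bau red) mzr mst' bu bv (esym eb).
- by move=> k; rewrite -(beq_size bau) en; apply: IH.
- by rewrite -szu'.
split; first by move: szu'; rewrite eu size_rcons => -[].
by rewrite es et; case: lets => -[-> ->]; [left|right].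
Qed.

(** With rigidity known at all lengths, the conjugation equalities carried by [center_split]
    identify the reflections at the center and at the first end. *)
Lemma shadow_reflections p0 t0 s0 q0 (a := p0 ++ [:: t0; s0; t0] ++ q0)
    (x0 := nth 1 (refls 1 a) (size p0)) (c0 := nth 1 (refls 1 a) (size p0).+1) :
  reduced a -> M s0 t0 = Some 3 ->
  forall b, beq a b ->
  nth 1 (refls 1 b) (size p0).+1 = c0 /\
  forall p s t q, M s t = Some 3 -> b = p ++ [:: s; t; s] ++ q ->
    size p <= (size p0).+1 <= (size p).+2 ->
    size p = size p0 /\
    (nth 1 (refls 1 b) (size p) = x0 \/ nth 1 (refls 1 b) (size p) = x0 ^ c0).
Proof.
move=> red m0 b bab.
have [] := center_splitP (fun m _ => @rigidP m) red m0 bab.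
move=> u [t [s [v [u' [v' [[mst bau szu] [[bu bv eb] [lets cen ends]]]]]]]].
have szu' := beq_size bu; rewrite size_rcons szu in szu'.
have ex0 : x0 = gen t0 ^ (val (rcons p0 t0))^-1.
  rewrite /x0 /a refls_window nth_cat size_refls ltnn subnn /=.
  by rewrite mulg1 val_rcons invgM genV.
have ec0 : c0 = gen s0 ^ (val (rcons p0 t0))^-1.
  rewrite /c0 /a refls_window nth_cat size_refls ltnNge leqnSn subSnn /=.
  by rewrite mulg1 val_rcons invgM genV.
split.
  by rewrite eb refls_cat nth_cat size_refls szu' ltnn subnn /= mulg1 cen ec0.
move=> p s' t' q mst' eb' szp.
rewrite eb' in eb; rewrite szu' in szp.
have [eu ev es et] :=
  rigid_separated (fun m _ => @rigidP m) (reduced_beq bau red) mst mst' bu bv (esym eb) szp.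
split; first by move: szu'; rewrite eu size_rcons => -[].
rewrite eb' refls_window nth_cat size_refls ltnn subnn /= mulg1.
by subst s' t'; rewrite eu val_rcons invgM genV -ec0 -ex0 in ends.
Qed.

(** Relations between the three reflections of a dihedral group of order six, in a form symmetric in
    the ends [a] and [e]. *)
Definition braid_triple (a c e : W) : Prop :=
  [/\ e = a ^ c, a = e ^ c, c = a ^ e & c = e ^ a].

Lemma braid_triple_sym (a c e : W) : braid_triple a c e -> braid_triple e c a.
Proof. by case. Qed.

Lemma braid_triple_conj (a c e h : W) :
  braid_triple a c e -> braid_triple (a ^ h) (c ^ h) (e ^ h).
Proof. by case=> *; split; rewrite -conjJg; congr (_ ^ _). Qed.

Lemma gen_conjC s t : M s t = Some 3 -> gen s ^ gen t = gen t ^ gen s.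
Proof. by move=> m; rewrite !conjgE !genV !mulgA (gen3 m). Qed.

Lemma gen_conjK s x : (x ^ gen s) ^ gen s = x.
Proof. by rewrite -conjgM gen2 conjg1. Qed.

Lemma gen_conj1 s : gen s ^ gen s = gen s.
Proof. by rewrite conjgE mulKg. Qed.

Lemma gen_braid_triple s t : M s t = Some 3 ->
  braid_triple (gen s) (gen t ^ gen s) (gen t).
Proof.
move=> m; have e := gen_conjC m.
have st : gen s ^ (gen s ^ gen t) = gen t.
  by rewrite e -{1}(gen_conj1 s) -conjJg e gen_conjK.
have ts : gen t ^ (gen t ^ gen s) = gen s.
  by rewrite -e -{1}(gen_conj1 t) -conjJg -e gen_conjK.
by split; rewrite // -?e ?st // e.
Qed.

(** As [s^t = t^s], the two windows hold the same reflections in opposite orders; as [sts = tst],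
    the parameter after the window is the same. *)
Lemma refls_bmove k p s t q : M s t = Some 3 ->
  exists (A B : seq W) (a c e : W), [/\ size A = size p,
    refls k (p ++ [:: s; t; s] ++ q) = A ++ [:: a; c; e] ++ B,
    refls k (p ++ [:: t; s; t] ++ q) = A ++ [:: e; c; a] ++ B &
    braid_triple a c e].
Proof.
move=> m; have mts : M t s = Some 3 by rewrite cox_sym.
set k0 := (val p)^-1 * k.
exists (refls k p), (refls ((val (p ++ [:: s; t; s]))^-1 * k) q),
  (gen s ^ k0), ((gen t ^ gen s) ^ k0), (gen t ^ k0).
have win r z : M r z = Some 3 ->
    refls k (p ++ [:: r; z; r] ++ q) =
    refls k p ++ [:: gen r ^ k0; (gen z ^ gen r) ^ k0; gen z ^ k0] ++
      refls ((val (p ++ [:: r; z; r]))^-1 * k) q.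
  move=> mrz; rewrite refls_window.
  rewrite -conjJg !(conjgM _ (gen r)).
  by rewrite gen_conj1 (gen_conjC mrz) gen_conjK.
split; first by rewrite size_refls.
- by rewrite win.
- rewrite win // !val_cat (val_braid mts) -!val_cat.
  by rewrite (gen_conjC m).
exact/braid_triple_conj/gen_braid_triple.
Qed.

Hypothesis gen_comm : forall s t, M s t = Some 2 -> gen s * gen t = gen t * gen s.
Hypothesis gen_inj : injective gen.
Hypothesis laced : simply_laced M.

(** Converse of [refls_bmove]. By injectivity of [gen], [e = a^c] forces the third letter to be the
    first; then [c = a^e] yields [t^s = s^t], which excludes commuting letters. *)
Lemma shadow_of_refls k b A B (a c e : W) : reduced b ->
  refls k b = A ++ [:: a; c; e] ++ B -> braid_triple a c e ->
  exists p s t q, [/\ M s t = Some 3, b = p ++ [:: s; t; s] ++ q & size p = size A].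
Proof.
move=> red eb [e1 _ e2 _].
have szb : size b = size A + 3 + size B.
  by rewrite -(size_refls k) eb !size_cat addnA.
have : b = take (size A) b ++ drop (size A) b by rewrite cat_take_drop.
have szt : size (take (size A) b) = size A by rewrite size_takel //; lia.
have : size (drop (size A) b) = 3 + size B by rewrite size_drop; lia.
case: (drop _ b) => [|s [|t [|u q]]] //= _ eb'.
exists (take (size A) b), s, t, q.
move: eb; rewrite {1}eb' refls_cat => /eqP; rewrite eqseq_cat ?size_refls //.
case/andP=> _ /eqP[] ea ec ee _.
set k0 := _ * k in ea ec ee; clearbody k0; rewrite !conjgM in ec ee.
have us : u = s.
  apply: gen_inj; apply/(@conjg_inj _ (gen t))/(@conjg_inj _ (gen s))/(@conjg_inj _ k0).
  rewrite ee e1 -ea -ec -conjJg; congr (_ ^ _).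
  by rewrite -{1}(gen_conj1 s) -conjJg.
subst u.
have tE : gen t = gen s ^ (gen s ^ gen t).
  apply/(@conjg_inj _ (gen s))/(@conjg_inj _ k0).
  rewrite ec e2 -ea -ee -conjJg; congr (_ ^ _).
  by rewrite [RHS]conjJg gen_conj1.
have ts : gen t ^ gen s = gen s ^ gen t.
  have tE2 : gen t = (gen s ^ gen t) ^ gen s.
    by rewrite -{1}(gen_conj1 t) {1}tE conjJg gen_conjK.
  by rewrite {1}tE2 gen_conjK.
have nst : s != t.
  apply/eqP=> est; subst t; apply: (@ss_not_reduced (take (size A) b) s (s :: q)).
  by rewrite -eb'.
split=> //.
have [m mst] := laced s t; have := cox_offdiag nst mst.
case: m => [|[|[|[|//]]]] // in mst * => _ _.
(* For exponent 2, [s^t = s], so that [t^s = s^t] collapses to [t = s]. *)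
case/eqP: nst; apply: gen_inj.
have st : gen s ^ gen t = gen s by rewrite conjgE (gen_comm mst) mulKg.
by rewrite -[RHS](gen_conjK s) ts st gen_conj1.
Qed.

Lemma refls_inj k : injective (refls k).
Proof.
move=> a; elim: a k => [|s a IH] k [|t b] //= [/conjg_inj/gen_inj est].
by subst t => /IH ->.
Qed.

(** * The braid graph *)

Section BraidClass.
Variables (n : nat) (alpha : n.-tuple S).
Hypothesis alpha_reduced : reduced alpha.

Lemma braid_moveE (a b : n.-tuple S) : braid_move M a b <-> bmove M a b.
Proof.
split=> [/existsP[i /existsP[s /existsP[t /and3P[/eqP m /eqP ea /eqP eb]]]]|].
  by exists (take i a), s, t, (drop (i + 3) a).
move=> [p [s [t [q [m ea eb]]]]].
have szp : size p < n by rewrite -(size_tuple a) ea !size_cat /=; lia.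
apply/existsP; exists (Ordinal szp); apply/existsP; exists s; apply/existsP; exists t.
have tp : take (size p) a = p by rewrite ea take_size_cat.
have dq : drop (size p + 3) a = q.
  by rewrite ea catA drop_size_cat // size_cat.
by rewrite m /= tp dq -ea -eb !eqxx.
Qed.

Lemma braid_shadowE (a : n.-tuple S) (i : 'I_n) :
  braid_shadow M a i <->
  exists p s t q,
    [/\ M s t = Some 3, tval a = p ++ [:: s; t; s] ++ q & size p = i].
Proof.
split=> [/existsP[s /existsP[t /andP[/eqP m /prefixP[q eq]]]]|].
  exists (take i a), s, t, q; split=> //.
    by rewrite -eq cat_take_drop.
  by rewrite size_takel // size_tuple ltnW.
move=> [p [s [t [q [m ea szp]]]]]; apply/existsP; exists s; apply/existsP; exists t.
by rewrite m eqxx ea -szp drop_size_cat // prefix_prefix.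
Qed.

Lemma braid_class_beq (b : n.-tuple S) : b \in braid_class M alpha -> beq alpha b.
Proof.
rewrite inE => /connectP[p pp ->] {b}.
elim/last_ind: p pp => [|p b IH] /=; first by move=> _; exact: beq_refl.
rewrite rcons_path last_rcons => /andP[/IH ab /braid_moveE]; exact: beq_step.
Qed.

Lemma beq_braid_class b : beq alpha b ->
  exists2 bt : n.-tuple S, tval bt = b & bt \in braid_class M alpha.
Proof.
elim=> [|{}b c _ [bt eb bin] bc]; first by exists alpha; rewrite ?inE.
have szc : size c == n by rewrite -(bmove_size bc) -eb size_tuple.
exists (Tuple szc) => //; move: bin; rewrite !inE => bin.
by apply: connect_trans bin (connect1 _); apply/braid_moveE; rewrite eb.
Qed.

Lemma mem_bs_class p s t q : M s t = Some 3 ->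
  beq alpha (p ++ [:: s; t; s] ++ q) ->
  exists2 i : 'I_n, i \in bs_class M alpha & size p = i.
Proof.
move=> m ab; have [b eb bin] := beq_braid_class ab.
have szp : size p < n by rewrite -(size_tuple b) eb !size_cat /=; lia.
exists (Ordinal szp) => //; apply/bigcupP; exists b => //.
by rewrite inE; apply/braid_shadowE; exists p, s, t, q.
Qed.

(** The word showing the shadow is left unspecified: by rigidity the triple depends on it only up to
    exchanging [x] and [y]. *)
Definition shadow_data (i : nat) (x c y : W) : Prop :=
  exists p s t q (A B : seq W),
    [/\ M s t = Some 3, size p = i & beq alpha (p ++ [:: s; t; s] ++ q)] /\
    [/\ size A = i, refls 1 (p ++ [:: s; t; s] ++ q) = A ++ [:: x; c; y] ++ B &
        braid_triple x c y].

Lemma shadow_data_exists (i : 'I_n) : i \in bs_class M alpha ->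
  exists x c y, shadow_data i x c y.
Proof.
move=> /bigcupP[b /braid_class_beq ab]; rewrite inE.
move=> /braid_shadowE[p [s [t [q [m eb szp]]]]].
have [A [B [a [c [e [szA eA _ tr]]]]]] := refls_bmove 1 p q m.
exists a, c, e, p, s, t, q, A, B; split; split=> //; first by rewrite -eb.
by rewrite szA.
Qed.

Lemma shadow_data_center i x c y b : shadow_data i x c y -> beq alpha b ->
  nth 1 (refls 1 b) i.+1 = c /\
  forall p s t q, M s t = Some 3 -> b = p ++ [:: s; t; s] ++ q ->
    size p <= i.+1 <= (size p).+2 ->
    size p = i /\ (nth 1 (refls 1 b) i = x \/ nth 1 (refls 1 b) i = y).
Proof.
move=> [p [s [t [q [A [B [[m szp ab] [szA eA [ey _ _ _]]]]]]]]] abb.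
have mts : M t s = Some 3 by rewrite cox_sym.
have [] := shadow_reflections (reduced_beq ab alpha_reduced) mts
             (beq_trans (beq_sym ab) abb).
rewrite eA szp -szA !nth_cat ltnn subnn ltnNge leqnSn subSnn /= -ey.
move=> -> H; split=> // p' s' t' q' m' eb' szp'.
by have [e1 e2] := H _ _ _ _ m' eb' szp'; rewrite e1 in e2.
Qed.

Lemma shadow_data_size i x c y : shadow_data i x c y -> i.+2 < n.
Proof.
move=> [p [s [t [q [A [B [[_ <- ab] _]]]]]]].
by rewrite -(size_tuple alpha) (beq_size ab) !size_cat /=; lia.
Qed.

(** In every word of the class [c] occupies position [i.+1]. In a word showing the shadow at [j],
    that position therefore lies in the window of this shadow, and rigidity applies. *)
Lemma shadow_data_touch i x c y j x' c' y' :
  shadow_data i x c y -> shadow_data j x' c' y' ->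
  c \in [:: x'; c'; y'] -> i = j.
Proof.
move=> di [p [s [t [q [A [B [[m szp ab] [szA eA tr]]]]]]]] cin.
have [ec touch] := shadow_data_center di ab.
have u := refls_uniq 1 (reduced_beq ab alpha_reduced).
have idx : index c (refls 1 (p ++ [:: s; t; s] ++ q)) = i.+1.
  rewrite -ec index_uniq // size_refls -(beq_size ab) size_tuple.
  by have := shadow_data_size di; lia.
rewrite eA in u idx; move: cin; rewrite (mem3_index _ u) idx szA => le.
by have [|<- _] := touch _ _ _ _ m (erefl _); rewrite szp.
Qed.

Lemma shadow_data_move p s t q x c y : M s t = Some 3 ->
  beq alpha (p ++ [:: s; t; s] ++ q) -> shadow_data (size p) x c y ->
  exists (A B : seq W) (a e : W),
    [/\ refls 1 (p ++ [:: s; t; s] ++ q) = A ++ [:: a; c; e] ++ B,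
        refls 1 (p ++ [:: t; s; t] ++ q) = A ++ [:: e; c; a] ++ B &
        (a, e) = (x, y) \/ (a, e) = (y, x)].
Proof.
move=> m ab d; have [ec touch] := shadow_data_center d ab.
have [A [B [a [c' [e [szA eA eA' [ee _ _ _]]]]]]] := refls_bmove 1 p q m.
have [|_ ends] := touch _ _ _ _ m (erefl _); first by rewrite leqnSn /=; lia.
have cc : c' = c.
  by rewrite -ec eA nth_cat szA ltnNge leqnSn subSnn.
subst c'; exists A, B, a, e; split=> //.
move: ends; rewrite eA nth_cat szA ltnn subnn /=.
have [p' [s' [t' [q' [A' [B' [_ [_ _ [ey ex _ _]]]]]]]]] := d.
by case=> ea; [left | right]; congr (_, _) => //; rewrite ee ea.
Qed.

Local Notation r := (rank M alpha).

Definition shadow_pos (k : 'I_r) : 'I_n := @enum_val _ (mem (bs_class M alpha)) k.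

Section Data.
Variables (x c y : 'I_r -> W).
Hypothesis data : forall k, shadow_data (shadow_pos k) (x k) (c k) (y k).

Local Notation triple := (triple x c y).
Local Notation reachable := (reachable x c y (refls 1 alpha)).

Lemma center_triple i j : c i \in triple j -> i = j.
Proof.
move=> /(shadow_data_touch (data i) (data j)) e.
by apply: (@enum_val_inj _ (mem (bs_class M alpha))); apply: ord_inj.
Qed.

Lemma data_braid k : braid_triple (x k) (c k) (y k).
Proof. by have [p [s [t [q [A [B [_ []]]]]]]] := data k. Qed.

Lemma refls_alpha_uniq : uniq (refls 1 alpha).
Proof. exact: refls_uniq. Qed.

Lemma ends_neq k : x k != y k.
Proof.
have [p [s [t [q [A [B [[_ _ ab] [_ eA _]]]]]]]] := data k.
have := refls_uniq 1 (reduced_beq ab alpha_reduced).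
rewrite eA cat_uniq /= !inE !negb_or.
by move=> /and3P[_ _ /andP[/and3P[]]].
Qed.

(** The center is determined by the ends, being the conjugate of either by the other; so common ends
    would give a common center, against [center_triple]. *)
Lemma ends_triple i j : x i \in triple j -> y i \in triple j -> i = j.
Proof.
move=> xj yj; have nxy := ends_neq i.
have [e|ne] := eqVneq i j => //; exfalso.
have nc z : z \in triple i -> z != c j.
  by move=> zi; apply: contraNneq ne => e; rewrite eq_sym (center_triple (i := j) (j := i)) // -e.
have [xi yi] : x i \in triple i /\ y i \in triple i by rewrite !inE !eqxx !orbT.
have [_ _ ci ci'] := data_braid i; have [_ _ cj cj'] := data_braid j.
have cij : c i = c j.
  move: xj yj; rewrite !inE (negbTE (nc _ xi)) (negbTE (nc _ yi)) /=.
  move=> /orP[]/eqP ex /orP[]/eqP ey; move: nxy; rewrite ex ey ?eqxx // => _.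
    by rewrite ci ex ey -cj.
  by rewrite ci ex ey -cj'.
by move: ne; rewrite (center_triple (i := i) (j := j)) ?eqxx // cij !inE eqxx orbT.
Qed.

Lemma reachable_bmove p s t q k E : M s t = Some 3 ->
  beq alpha (p ++ [:: s; t; s] ++ q) -> size p = shadow_pos k ->
  reachable (refls 1 (p ++ [:: s; t; s] ++ q)) E ->
  reachable (refls 1 (p ++ [:: t; s; t] ++ q)) [set j | (j \in E) (+) (j == k)].
Proof.
move=> m ab szp; have := data k; rewrite -szp => d.
have [A [B [a [e [-> -> ae]]]]] := shadow_data_move m ab d.
by move=> rE; apply: reachable_step.
Qed.

Lemma bs_class_index (i : 'I_n) : i \in bs_class M alpha ->
  exists k : 'I_r, shadow_pos k = i.
Proof. by move=> ib; exists (enum_rank_in ib i); rewrite /shadow_pos enum_rankK_in. Qed.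

Lemma reachable_beq b : beq alpha b -> exists E, reachable (refls 1 b) E.
Proof.
elim=> [|{}b d ab [E rE] [p [s [t [q [m eb ed]]]]]].
  by exists set0; apply: reachable0.
subst b d; have [i ib szp] := mem_bs_class m ab.
have [k ek] := bs_class_index ib; rewrite -ek in szp.
by eexists; apply: reachable_bmove rE => //; exact: szp.
Qed.

Lemma triple_sub k : {subset triple k <= refls 1 alpha}.
Proof.
have [p [s [t [q [A [B [[_ _ ab] [_ eA _]]]]]]]] := data k.
have [E rE] := reachable_beq ab => z zk.
by rewrite -(reachable_mem rE) eA !mem_cat zk orbT.
Qed.

(** In the word witnessing [data k] the triple is consecutive, and [reachable_between] carries this
    order to [b] up to reversal. *)
Lemma data_between k b : beq alpha b ->
  before (refls 1 b) (x k) (c k) && before (refls 1 b) (c k) (y k) \/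
  before (refls 1 b) (y k) (c k) && before (refls 1 b) (c k) (x k).
Proof.
move=> ab; have [E rE] := reachable_beq ab.
have [p [s [t [q [A [B [[_ _ ab'] [_ eA _]]]]]]]] := data k.
have [E' rE'] := reachable_beq ab'; rewrite eA in rE'.
have [xc cy] := before_window (reachable_uniq refls_alpha_uniq rE').
exact: (reachable_between center_triple ends_triple refls_alpha_uniq rE' rE
          (triple_sub (k := k)) xc cy).
Qed.

(** * Signatures of words and descent of the Hamming distance *)

Definition signature (b : seq S) : r.-tuple bool :=
  [tuple before (refls 1 b) (x k) (y k) | k < r].

(** Each signature differs from its set by one fixed string, the signature of [alpha], which
    cancels. *)
Lemma signature_diff b1 b2 E1 E2 j :
  reachable (refls 1 b1) E1 -> reachable (refls 1 b2) E2 ->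
  (tnth (signature b1) j != tnth (signature b2) j) = ((j \in E1) != (j \in E2)).
Proof.
move=> rE1 rE2; rewrite !tnth_mktuple.
have [xr yr] : x j \in refls 1 alpha /\ y j \in refls 1 alpha.
  by split; apply: (triple_sub (k := j)); rewrite !inE eqxx ?orbT.
rewrite (reachable_bit center_triple ends_triple refls_alpha_uniq rE1) ?ends_neq //.
rewrite (reachable_bit center_triple ends_triple refls_alpha_uniq rE2) ?ends_neq //.
by do 3!case: (before _ _ _).
Qed.

Lemma signature_bmove b1 b2 : beq alpha b1 -> bmove M b1 b2 ->
  hypercube (signature b1) (signature b2).
Proof.
move=> ab [p [s [t [q [m e1 e2]]]]]; subst b1 b2.
have [E rE] := reachable_beq ab; have [i ib szp] := mem_bs_class m ab.
have [k ek] := bs_class_index ib; rewrite -ek in szp.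
have rE' := reachable_bmove m ab szp rE.
rewrite /hypercube (_ : [set j | _] = [set k]) ?cards1 //.
apply/setP=> j; rewrite in_set (signature_diff _ rE rE') !inE.
by case: (j \in E); case: (j == k).
Qed.

Lemma signature_descent b1 b2 : beq alpha b1 -> beq alpha b2 -> b1 <> b2 ->
  exists2 b, bmove M b1 b &
    hamming (signature b) (signature b2) < hamming (signature b1) (signature b2).
Proof.
move=> ab1 ab2 nb; have [E1 rE1] := reachable_beq ab1; have [E2 rE2] := reachable_beq ab2.
have u1 := reachable_uniq refls_alpha_uniq rE1; have u2 := reachable_uniq refls_alpha_uniq rE2.
have m1 := reachable_mem rE1; have m2 := reachable_mem rE2.
pose H := [set j | (j \in E1) != (j \in E2)].
have bef (p q : W) : p \in refls 1 alpha -> q \in refls 1 alpha -> p != q ->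
    before (refls 1 b1) p q (+) before (refls 1 b2) p q =
    [exists j in H, (p \in triple j) && (q \in triple j)].
  exact: (reachable_before2 center_triple ends_triple refls_alpha_uniq rE1 rE2).
(* With [H] empty, all pairs of reflections would be ordered alike in both words, which would then
   coincide. *)
have H0 : H != set0.
  apply/eqP=> H0; apply/nb/(@refls_inj 1)/(before_eq u1 u2).
    by move=> z; rewrite m1 m2.
  move=> p q; rewrite !m1 => pr qr npq; have := bef _ _ pr qr npq.
  rewrite H0 (_ : [exists j in set0, _] = false).
    by case: (before _ p q); case: (before _ p q).
  by apply/exists_inP=> -[j]; rewrite inE.
have [k kH alone] : exists2 k, k \in H & forall z, z \in refls 1 alpha -> z != c k ->
    ~ (index (x k) (refls 1 b1) < index z (refls 1 b1) < index (y k) (refls 1 b1) \/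
       index (y k) (refls 1 b1) < index z (refls 1 b1) < index (x k) (refls 1 b1)).
  apply: (@minimal_reversed_triple _ _ x c y center_triple ends_triple
            [in refls 1 alpha] (index^~ (refls 1 b1)) (index^~ (refls 1 b2))) => //.
  - by move=> p q pr qr; apply: (index_inj p); rewrite m1.
  - by move=> p q pr qr; apply: (index_inj p); rewrite m2.
  - exact: triple_sub.
  - by move=> j; have := data_between j ab1; rewrite /before.
  - move=> j p q jH pj qj npq.
    have := bef _ _ (triple_sub pj) (triple_sub qj) npq.
    rewrite (exists_pair center_triple ends_triple _ npq pj qj) jH /before.
    by do 2!case: (_ < _).
  - move=> p q pr qr npq /negbTE none; have := bef _ _ pr qr npq.
    by rewrite none /before; do 2!case: (_ < _).
have [ec _] := shadow_data_center (data k) ab1.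
have szr : (shadow_pos k).+2 < size (refls 1 b1).
  by rewrite size_refls -(beq_size ab1) size_tuple; apply: shadow_data_size (data k).
set i : nat := shadow_pos k in ec szr.
have idc : index (c k) (refls 1 b1) = i.+1 by rewrite -ec index_uniq // ltnW.
have adj (a e : W) : a \in triple k -> e \in triple k ->
    before (refls 1 b1) a (c k) && before (refls 1 b1) (c k) e ->
    (forall z, z \in refls 1 alpha -> z != c k ->
      ~ (index a (refls 1 b1) < index z (refls 1 b1) < index e (refls 1 b1))) ->
    nth 1 (refls 1 b1) i = a /\ nth 1 (refls 1 b1) i.+2 = e.
  move=> /triple_sub; rewrite -m1 => ar /triple_sub; rewrite -m1 => er.
  rewrite /before idc => /andP[lta lte] none.
  (* The center sits at [i.+1]; a gap between it and an end would contain another reflection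
     strictly between the ends. *)
  have out j : j < size (refls 1 b1) -> j != i.+1 ->
      ~ (index a (refls 1 b1) < j < index e (refls 1 b1)).
    move=> ltj nj; have := none (nth 1 (refls 1 b1) j).
    rewrite -m1 mem_nth // index_uniq //; apply=> //.
    by rewrite -ec nth_uniq // ltnW.
  have ia : index a (refls 1 b1) = i.
    by have := out i; clear -lta lte szr; lia.
  have ie : index e (refls 1 b1) = i.+2.
    by have := out i.+2; clear -lta lte szr; lia.
  by rewrite -{1}ia -ie !nth_index.
have [xk yk] : x k \in triple k /\ y k \in triple k by rewrite !inE !eqxx !orbT.
have tr : braid_triple (nth 1 (refls 1 b1) i) (c k) (nth 1 (refls 1 b1) i.+2).
  case: (data_between k ab1) => bw.
    have [|-> ->] := adj _ _ xk yk bw; last exact: data_braid.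
    by move=> z zr zc lt; apply: (alone z) => //; left.
  have [|-> ->] := adj _ _ yk xk bw; last exact/braid_triple_sym/data_braid.
  by move=> z zr zc lt; apply: (alone z) => //; right.
have := window_nth 1 szr; rewrite ec => ew.
have [p [s [t [q [m eb szp]]]]] := shadow_of_refls (reduced_beq ab1 alpha_reduced) ew tr.
subst b1; exists (p ++ [:: t; s; t] ++ q); first by exists p, s, t, q.
have szpk : size p = shadow_pos k by rewrite szp size_takel //; clear -szr; lia.
have rE := reachable_bmove m ab1 szpk rE1.
(* The move changes coordinate [k] only, where the two signatures disagreed. *)
apply/proper_card/properP; split.
  apply/subsetP=> j; rewrite !in_set (signature_diff _ rE rE2) (signature_diff _ rE1 rE2) in_set.
  have [->|_] := eqVneq j k; last by rewrite addbF.
  by move: kH; rewrite in_set => ->.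
exists k; rewrite !in_set ?(signature_diff _ rE rE2) ?(signature_diff _ rE1 rE2).
  by move: kH; rewrite in_set.
by move: kH; rewrite !in_set eqxx; do 2!case: (k \in _).
Qed.

End Data.
Lemma braid_graph_embeds :
  isometrically_embeds (braid_graph M alpha) (@hypercube r).
Proof.
have ex (k : 'I_r) : exists u : W * W * W,
    shadow_data (shadow_pos k) u.1.1 u.1.2 u.2.
  have [x [c [y xcy]]] := shadow_data_exists (enum_valP k).
  by exists (x, c, y).
(* One triple is chosen for each shadow position; naming its ends the other way would only
   complement that coordinate. *)
have [d data] := fin_all_exists ex.
exists (fun v : braid_vertex M alpha =>
  signature (fun k => (d k).1.1) (fun k => (d k).2) (tval (sval v))).
apply: isometric_of_descent => [v w /braid_moveE vw|v w nvw].
  exact: signature_bmove data _ _ (braid_class_beq (valP v)) vw.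
have [|b vb lt] := signature_descent data (braid_class_beq (valP v))
    (braid_class_beq (valP w)).
  by move/val_inj/val_inj=> e; rewrite e eqxx in nvw.
have [bt ebt bin] := beq_braid_class (beq_step (braid_class_beq (valP v)) vb).
exists (Sub bt bin); last by rewrite /= ebt.
by apply/braid_moveE; rewrite /= ebt.
Qed.

End BraidClass.

End ReducedWords.

Theorem theorem5p17 (S : finType) (M : coxeter_matrix S)
    (W : groupType) (gen : S -> W) (hWS : coxeter_system M gen)
    (hsl : simply_laced M) (htf : triangle_free M)
    (n : nat) (alpha : n.-tuple S) (w : W) (hw : w <> 1%g)
    (hred : reduced_expression gen alpha w) :
  isometrically_embeds (braid_graph M alpha) (@hypercube (rank M alpha)) /\
  partial_cube (braid_graph M alpha) /\
  (exists2 d : nat, isometric_dimension (braid_graph M alpha) d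
                  & d <= rank M alpha).
Proof.
have [rel _] := hWS.
have gen2 s : gen s * gen s = 1.
  by rewrite -[LHS]expg1; apply: rel; apply: cox_diag.
have gen3 s t : M s t = Some 3 -> gen s * gen t * gen s = gen t * gen s * gen t.
  move=> /rel; rewrite 2!expgS expg1 !mulgA => e.
  (* Multiplied by [tst] on the right, the two sides become [(st)^3] and [(tst)^2], both trivial. *)
  apply: (mulIg (gen t * gen s * gen t)); rewrite !mulgA e.
  rewrite -!mulgA (mulgA (gen t) (gen t)) gen2 mul1g.
  by rewrite (mulgA (gen s) (gen s)) gen2 mul1g gen2.
have gen_comm s t : M s t = Some 2 -> gen s * gen t = gen t * gen s.
  move=> /rel; rewrite expgS expg1 !mulgA => e.
  apply: (mulIg (gen s * gen t)); rewrite !mulgA e.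
  by rewrite -!mulgA (mulgA (gen s) (gen s)) gen2 mul1g gen2.
have no_triangle s t r : M s t = Some 3 -> M s r = Some 3 -> M t r <> Some 3.
  move=> st sr tr; apply: (htf s t r); rewrite /coxeter_edge st tr.
  by rewrite cox_sym sr.
have gen_inj := coxeter_gen_inj hsl hWS.
have red : reduced gen alpha by case: hred => e min b; rewrite e; apply: min.
have emb := braid_graph_embeds gen2 gen3 no_triangle gen_comm gen_inj hsl red.
split=> //; split; first by exists (rank M alpha).
exact: isometric_dimension_exists.
Qed.
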